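(* Let $R=k[[x,y]]$ with maximal ideal $\mathfrak m$, and let $m\ge 0$ be an integer. (1) ($A_{n-1}$) Let $I=(x^2+y^n)$ with $n\ge 3$. If $m\le n$ then $I^{m\text{-}jc}=I+\mathfrak m^{m+1}$; and if $m=n+1$ then $I^{m\text{-}jc}=\mathfrak m^{m+1}+I+(x^3)$. (2) ($D_n$) Let $I=(x^2y+y^{n-1})$ with $n\ge 4$. If $m\le n-1$ then $I^{m\text{-}jc}=I+\mathfrak m^{m+1}$. (3) ($E_6$) Let $I=(x^3+y^4)$. If $m\le 4$ then $I^{m\text{-}jc}=I+\mathfrak m^{m+1}$. (4) ($E_7$) Let $I=(x^3+xy^3)$. If $m\le 4$ then $I^{m\text{-}jc}=I+\mathfrak m^{m+1}$. (5) ($E_8$) Let $I=(x^3+y^5)$. If $m\le 5$ then $I^{m\text{-}jc}=I+\mathfrak m^{m+1}$.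
   Context: $k$ is an algebraically closed field of characteristic $0$. For an integer $m\ge 0$ put $P_m=k[x^{(j)},y^{(j)}: 1\le j\le m]$. For $g\in R=k[[x,y]]$ define $D_0(g),\dots,D_m(g)\in P_m$ by $$g\Big(\sum_{j=1}^m x^{(j)}t^j,\ \sum_{j=1}^m y^{(j)}t^j\Big)\equiv\sum_{j=0}^m D_j(g)\,t^j \pmod{t^{m+1}}.$$ For an ideal $I\subset R$ let $\overline{I}_m\subset P_m$ be the ideal generated by all $D_j(g)$ with $g\in I$, $0\le j\le m$. (Here $P_m$ is the $m$-th jet ring $R_m$ modulo $\mathfrak m R_m$, and $\overline I_m$ is the image of the $m$-th jet ideal of $I$.) The $m$-th jet closure of $I$ is $$I^{m\text{-}jc}=\{f\in R: D_j(f)\in \overline I_m \text{ for all } 0\le j\le m\}.$$ *)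

(* Defs.v *)
From HB Require Import structures.
From mathcomp Require Import all_boot all_algebra.
From mathcomp Require Import boolp classical_sets.
From mathcomp Require Import mpoly.

Set Implicit Arguments.
Unset Strict Implicit.
Unset Printing Implicit Defensive.

Import GRing.Theory.
Local Open Scope classical_set_scope.
Local Open Scope ring_scope.

(* The ring k[[x,y]]: f i j is the coefficient of x^i y^j in f.               *)

Definition fps2 (k : comNzRingType) : Type := nat -> nat -> k.

HB.instance Definition _ (k : comNzRingType) := gen_eqMixin (fps2 k).
HB.instance Definition _ (k : comNzRingType) := gen_choiceMixin (fps2 k).

Section PowerSeriesRing.
Variable k : comNzRingType.
Implicit Types f g h : fps2 k.

Lemma fps2P f g : (forall i j, f i j = g i j) -> f = g.
Proof. by move=> fg; apply/funext => i; apply/funext => j. Qed.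

Definition fps2_zero : fps2 k := fun _ _ => 0.
Definition fps2_opp f : fps2 k := fun i j => - f i j.
Definition fps2_add f g : fps2 k := fun i j => f i j + g i j.
Definition fps2_one : fps2 k := fun i j => ((i == 0%N) && (j == 0%N))%:R.
Definition fps2_mul f g : fps2 k := fun i j =>
  \sum_(a < i.+1) \sum_(b < j.+1) f a b * g (i - a)%N (j - b)%N.

Fact fps2_addA : associative fps2_add.
Proof. by move=> f g h; apply: fps2P => i j; rewrite /fps2_add addrA. Qed.
Fact fps2_addC : commutative fps2_add.
Proof. by move=> f g; apply: fps2P => i j; rewrite /fps2_add addrC. Qed.
Fact fps2_add0 : left_id fps2_zero fps2_add.
Proof. by move=> f; apply: fps2P => i j; rewrite /fps2_add add0r. Qed.
Fact fps2_addN : left_inverse fps2_zero fps2_opp fps2_add.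
Proof. by move=> f; apply: fps2P => i j; rewrite /fps2_add addNr. Qed.

HB.instance Definition _ := GRing.isZmodule.Build (fps2 k)
  fps2_addA fps2_addC fps2_add0 fps2_addN.

(* p has the same coefficients as f on x^a y^b for a <= i, b <= j; the ring   *)
(* axioms are transported from {poly {poly k}} along this relation.           *)
Let agree i j (p : {poly {poly k}}) f :=
  forall a b, (a <= i)%N -> (b <= j)%N -> p`_a`_b = f a b.

Let trunc i j f : {poly {poly k}} := \poly_(a < i.+1) \poly_(b < j.+1) f a b.

Let agree_trunc i j f : agree i j (trunc i j f) f.
Proof. by move=> a b ai bj; rewrite coef_poly ltnS ai coef_poly ltnS bj. Qed.

Let agree_mul i j p q f g :
  agree i j p f -> agree i j q g -> agree i j (p * q) (fps2_mul f g).
Proof.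
move=> pf qg a b ai bj; rewrite coefM coef_sum; apply: eq_bigr => u _.
rewrite coefM; apply: eq_bigr => v _; rewrite pf ?qg //.
- exact: leq_trans (leq_subr _ _) ai.
- exact: leq_trans (leq_subr _ _) bj.
- exact: leq_trans (leq_ord u) ai.
- exact: leq_trans (leq_ord v) bj.
Qed.

Let agreeP f g :
  (forall i j, exists2 p, agree i j p f & agree i j p g) -> f = g.
Proof.
move=> fg; apply: fps2P => i j; have [p pf pg] := fg i j.
by rewrite -pf // -pg.
Qed.

Fact fps2_mulA : associative fps2_mul.
Proof.
move=> f g h; apply: agreeP => i j.
exists (trunc i j f * (trunc i j g * trunc i j h)); last rewrite mulrA;
  by do ?apply: agree_mul; apply: agree_trunc.
Qed.

Fact fps2_mulC : commutative fps2_mul.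
Proof.
move=> f g; apply: agreeP => i j.
exists (trunc i j f * trunc i j g); last rewrite mulrC;
  by do ?apply: agree_mul; apply: agree_trunc.
Qed.

Fact fps2_mul1 : left_id fps2_one fps2_mul.
Proof.
move=> f; apply: agreeP => i j; exists (1 * trunc i j f); last first.
  by rewrite mul1r; apply: agree_trunc.
apply: agree_mul; last exact: agree_trunc.
move=> a b _ _; rewrite coef1 /fps2_one.
by case: (a == 0%N); rewrite /= ?coef1 ?coef0.
Qed.

Fact fps2_mulD : left_distributive fps2_mul +%R.
Proof.
move=> f g h; apply: fps2P => i j; rewrite /fps2_mul /GRing.add /= /fps2_add.
rewrite -big_split; apply: eq_bigr => a _ /=.
by rewrite -big_split; apply: eq_bigr => b _; rewrite mulrDl.
Qed.

Fact fps2_oner_neq0 : fps2_one != 0.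
Proof.
by apply/eqP => /(congr1 (fun f : fps2 k => f 0 0)%N) /eqP; rewrite oner_eq0.
Qed.

HB.instance Definition _ := GRing.Zmodule_isComNzRing.Build (fps2 k)
  fps2_mulA fps2_mulC fps2_mul1 fps2_mulD fps2_oner_neq0.

Definition fps2X : fps2 k := fun i j => ((i == 1%N) && (j == 0%N))%:R.
Definition fps2Y : fps2 k := fun i j => ((i == 0%N) && (j == 1%N))%:R.

Definition fps2_maxideal : set (fps2 k) := [set f | f 0%N 0%N = 0].

End PowerSeriesRing.

Arguments fps2X : clear implicits.
Arguments fps2Y : clear implicits.
Arguments fps2_maxideal : clear implicits.

Section Ideals.
Variable R : comNzRingType.
Implicit Types S I J : set R.

Definition ideal_gen S : set R :=
  [set f | exists2 s : seq (R * R), (forall p, p \in s -> S p.2) &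
           f = \sum_(p <- s) p.1 * p.2].

Definition ideal_add I J : set R := [set f + g | f in I & g in J].

Definition ideal_mul I J : set R := ideal_gen [set f * g | f in I & g in J].

Definition ideal_exp I (n : nat) : set R := iter n (ideal_mul I) setT.

End Ideals.

Section Jets.
Variables (k : comNzRingType) (m : nat).

(* The 2m variables of P_m: for i < m, x^(i+1) is the variable of index i and *)
(* y^(i+1) the variable of index m + i.                                       *)
Definition jet_ring := {mpoly k[m + m]}.

Definition arcX : {poly jet_ring} := \sum_(i < m) 'X_(lshift m i) *: 'X^(i.+1).
Definition arcY : {poly jet_ring} := \sum_(i < m) 'X_(rshift m i) *: 'X^(i.+1).

Definition jet_subst (N : nat) (g : fps2 k) : {poly jet_ring} :=
  \sum_(a < N.+1) \sum_(b < N.+1) (g a b)%:MP *: (arcX ^+ a * arcY ^+ b).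

(* arcX and arcY have no constant term in t, so only the monomials x^a y^b    *)
(* of g with a, b <= m contribute to g(arcX, arcY) modulo t^(m+1), which makes *)
(* the truncation below harmless: see jetD_bound.                             *)
Definition jetD (j : nat) (g : fps2 k) : jet_ring := (jet_subst m g)`_j.

Let coef_exp_lt (u : 'I_m -> jet_ring) a j :
  (j < a)%N -> ((\sum_(i < m) u i *: 'X^(i.+1)) ^+ a)`_j = 0.
Proof.
set p := \sum_(i < m) _; have -> : p = (\sum_(i < m) u i *: 'X^i) * 'X.
  by rewrite mulr_suml; apply: eq_bigr => i _; rewrite -scalerAl exprSr.
by move=> ja; rewrite exprMn_comm ?coefMXn ?ja //; apply: mulrC.
Qed.

Let coef_mono0 a b j :
  (j < a)%N || (j < b)%N -> (arcX ^+ a * arcY ^+ b)`_j = 0.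
Proof.
move=> jab; rewrite coefM big1 // => i _; case/orP: jab => [ja | jb].
  by rewrite coef_exp_lt ?mul0r //; apply: leq_ltn_trans ja; apply: leq_ord.
rewrite mulrC coef_exp_lt ?mul0r //.
by apply: leq_ltn_trans jb; apply: leq_subr.
Qed.

Lemma jetD_bound N j g :
  (m <= N)%N -> (j <= m)%N -> (jet_subst N g)`_j = jetD j g.
Proof.
move=> mN jm; rewrite /jetD /jet_subst !coef_sum.
rewrite [RHS](big_ord_widen N.+1 (fun a => (\sum_(b < m.+1)
  (g a b)%:MP *: (arcX ^+ a * arcY ^+ b))`_j)) //.
rewrite [RHS]big_mkcond; apply: eq_bigr => a _; rewrite !coef_sum ltnS.
case: ifPn => [am | ]; last first.
  rewrite -ltnNge => ma; apply: big1 => b _.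
  by rewrite coefZ coef_mono0 ?mulr0 // (leq_ltn_trans jm ma).
rewrite [RHS](big_ord_widen N.+1 (fun b =>
  ((g a b)%:MP *: (arcX ^+ a * arcY ^+ b))`_j)) //.
rewrite [RHS]big_mkcond; apply: eq_bigr => b _; rewrite ltnS.
case: ifPn => // ; rewrite -ltnNge => mb.
by rewrite coefZ coef_mono0 ?mulr0 // (leq_ltn_trans jm mb) orbT.
Qed.

Definition jet_ideal (I : set (fps2 k)) : set jet_ring :=
  ideal_gen [set p | exists j g, [/\ (j <= m)%N, I g & p = jetD j g]].

Definition jet_closure (I : set (fps2 k)) : set (fps2 k) :=
  [set f | forall j, (j <= m)%N -> jet_ideal I (jetD j f)].

End Jets.

(* Main.v *)
From HB Require Import structures.
Require Import Defs.
From mathcomp Require Import all_boot all_algebra.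
From mathcomp Require Import boolp classical_sets.
From mathcomp Require Import mpoly.
From mathcomp Require Import zify ring.

Set Implicit Arguments.
Unset Strict Implicit.
Unset Printing Implicit Defensive.

Import GRing.Theory.
Local Open Scope classical_set_scope.
Local Open Scope ring_scope.

(** An A-valued point of the jet ring is an arc (X(t), Y(t)) through the origin
    with coefficients in A, and D_j(f) takes there the value of the coefficient
    of t^j in f(X, Y). Hence, if f lies in the closure of (g) and the
    coefficients of g(X, Y) up to order m lie in an ideal J of A, then so do
    those of f(X, Y) (jet_closure_arc). The upper bounds on the closure all
    come from a few arcs with values in A = k[[u, v]]; all but one of the ideals J
    are spanned by monomials, so that membership is read off coefficients.

    The five families, for m at most the degree of the second monomial of g,
    are one statement (binomial_jet_closure) about
    g = x^p y^q + x^l y^(q+s) with p = l + w + 1 and s > w: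
    - dividing by g leaves an r without monomials divisible by x^p y^q;
    - the arc (u t, v t), with J generated by the two monomials of g, kills
      every coefficient of r of degree at most m, except that of x^l y^(q+s)
      when m = l + q + s (jet_closure_initial);
    - if the two monomials of g have different degrees, the arc
      X = u^s t - (v^s/p) t^(s-w), Y = u^w v t makes the terms of order m of
      X^p Y^q and of X^l Y^(q+s) cancel, while all else in g(X, Y) up to order
      m is divisible by (u^s)^p (u^w v)^q. The monomial X^l Y^(q+s) itself is
      not, so the last coefficient of r vanishes too;
    - if the degrees are equal, g(u t, v t) = g(u, v) t^m, and J = (g) does it.

    For x^2 + y^n and m = n + 1, the arc X = u^n t - (v^n/2) t^(n-1), Y = u v t
    with J = (u^(2n), v^(2n)) kills the coefficients of y^n and y^(n+1), but
    x y^n, which is -x^3 modulo g, survives. And x^3 does belong to the closure: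
    write S = X^2 for the universal arc. Its coefficients of order less than n
    lie in the jet ideal, so X S' = 2 S X' at order n reads
    (n - 2) X_1 S_n = 0 modulo that ideal, and X_1 S_n is all that is left of
    the coefficient of t^(n+1) in X^3 = X S. *)

(** * Coefficients of power series, ideals and powers of the maximal ideal *)

Section Monomials.
Variable k : comNzRingType.
Implicit Types (f g h : fps2 k) (c d : k) (i j a b : nat).

Definition fps2_monom c a b : fps2 k :=
  fun i j => if (i == a) && (j == b) then c else 0.

Lemma fps2_addE f g i j : (f + g) i j = f i j + g i j.
Proof. by []. Qed.

Lemma fps2_oppE f i j : (- f) i j = - f i j.
Proof. by []. Qed.

Lemma fps2_zeroE i j : (0 : fps2 k) i j = 0.
Proof. by []. Qed.

Lemma fps2_mulE f g i j : (f * g) i j =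
  \sum_(a < i.+1) \sum_(b < j.+1) f a b * g (i - a)%N (j - b)%N.
Proof. by []. Qed.

Lemma fps2_monomM c a b f i j : (fps2_monom c a b * f) i j =
  if (a <= i)%N && (b <= j)%N then c * f (i - a)%N (j - b)%N else 0.
Proof.
rewrite fps2_mulE; case: ifPn => [/andP[ai bj] | nab].
  have ai' : (a < i.+1)%N by []. have bj' : (b < j.+1)%N by [].
  rewrite (bigD1 (Ordinal ai')) //= (bigD1 (Ordinal bj')) //= /fps2_monom !eqxx.
  rewrite !big1 ?addr0 // => [u ua | v vb].
    apply: big1 => v _; case: eqP => [E|_]; last by rewrite mul0r.
    by case/eqP: ua; apply: val_inj.
  case: eqP => [E|_]; last by rewrite mul0r.
  by case/eqP: vb; apply: val_inj.
apply: big1 => u _; apply: big1 => v _; rewrite /fps2_monom.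
case: ifP => [/andP[/eqP ua /eqP vb]|_]; last by rewrite mul0r.
by case/negP: nab; rewrite -ua -vb !leq_ord.
Qed.

Lemma fps2_monomMM c d a b a' b' :
  fps2_monom c a b * fps2_monom d a' b' = fps2_monom (c * d) (a + a') (b + b').
Proof.
apply: fps2P => i j; rewrite fps2_monomM /fps2_monom.
case: (leqP a i) => /= ai; last by rewrite ifF //; lia.
case: (leqP b j) => /= bj; last by rewrite ifF //; lia.
rewrite -[X in _ = if X then _ else _]/((i == a + a') && (j == b + b'))%N.
have -> : (i - a == a')%N = (i == a + a')%N by lia.
have -> : (j - b == b')%N = (j == b + b')%N by lia.
by case: ifP => // _; rewrite mulr0.
Qed.

Lemma fps2_monom1 : fps2_monom 1 0 0 = 1.
Proof.
apply: fps2P => i j; rewrite -[RHS]/(((i == 0%N) && (j == 0%N))%:R : k).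
by rewrite /fps2_monom; case: ifP.
Qed.

Lemma fps2_monomX c a b n :
  fps2_monom c a b ^+ n = fps2_monom (c ^+ n) (n * a) (n * b).
Proof.
elim: n => [|n IH]; first by rewrite !expr0 fps2_monom1.
by rewrite !exprS IH fps2_monomMM -!mulSn.
Qed.

Lemma fps2XE : fps2X k = fps2_monom 1 1 0.
Proof. by apply: fps2P => i j; rewrite /fps2X /fps2_monom; case: ifP. Qed.

Lemma fps2YE : fps2Y k = fps2_monom 1 0 1.
Proof. by apply: fps2P => i j; rewrite /fps2Y /fps2_monom; case: ifP. Qed.

Lemma fps2_XY a b : fps2X k ^+ a * fps2Y k ^+ b = fps2_monom 1 a b.
Proof.
rewrite fps2XE fps2YE !fps2_monomX fps2_monomMM !expr1n mulr1.
by rewrite !muln1 !muln0 addn0.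
Qed.

Definition fps2C c : fps2 k := fps2_monom c 0 0.

Fact fps2C_is_zmod_morphism : zmod_morphism fps2C.
Proof.
move=> c d; apply: fps2P => i j.
rewrite fps2_addE fps2_oppE /fps2C /fps2_monom.
by case: ifP => // _; rewrite subr0.
Qed.

Fact fps2C_is_monoid_morphism : monoid_morphism fps2C.
Proof.
split; first exact: fps2_monom1.
by move=> c d; rewrite /fps2C fps2_monomMM.
Qed.

HB.instance Definition _ :=
  GRing.isZmodMorphism.Build k (fps2 k) fps2C fps2C_is_zmod_morphism.
HB.instance Definition _ :=
  GRing.isMonoidMorphism.Build k (fps2 k) fps2C fps2C_is_monoid_morphism.

Lemma fps2C_monom c d a b : fps2C c * fps2_monom d a b = fps2_monom (c * d) a b.
Proof. by rewrite /fps2C fps2_monomMM. Qed.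

(** This is membership in the n-th power of the maximal ideal, see maxideal_expP. *)
Definition high_order n f := forall a b, (a + b < n)%N -> f a b = 0.

Lemma high_orderM n f g : high_order n g -> high_order n (f * g).
Proof.
move=> gn a b ab; rewrite fps2_mulE big1 // => i _; rewrite big1 // => j _.
by rewrite gn ?mulr0 //; apply: leq_ltn_trans ab; rewrite leq_add ?leq_subr.
Qed.

Lemma high_orderD n f g : high_order n f -> high_order n g -> high_order n (f + g).
Proof. by move=> fn gn a b ab; rewrite fps2_addE fn // gn // addr0. Qed.

End Monomials.

Section IdealLemmas.
Variable R : comNzRingType.
Implicit Types (S : set R) (a b c : R).

Definition is_ideal S := [/\ S 0, forall a b, S a -> S b -> S (a + b) &
                             forall c a, S a -> S (c * a)].

Lemma ideal_gen_ideal S : is_ideal (ideal_gen S).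
Proof.
split.
- by exists [::]; rewrite ?big_nil.
- move=> _ _ [s sS ->] [t tS ->]; exists (s ++ t); last by rewrite big_cat.
  by move=> p; rewrite mem_cat => /orP[/sS|/tS].
- move=> c _ [s sS ->]; exists [seq (c * p.1, p.2) | p <- s].
    by move=> _ /mapP[p ps ->]; exact: (sS p ps).
  by rewrite big_map mulr_sumr; apply: eq_bigr => p _; rewrite mulrA.
Qed.

Lemma mem_ideal_gen S a : S a -> ideal_gen S a.
Proof.
move=> Sa; exists [:: (1, a)]; last by rewrite big_seq1 mul1r.
by move=> p; rewrite inE => /eqP ->.
Qed.

Lemma ideal_gen_sub S I : is_ideal I -> (forall a, S a -> I a) ->
  forall a, ideal_gen S a -> I a.
Proof.
move=> [I0 ID IM] SI _ [s sS ->]; elim: s sS => [|p s IH] sS; first by rewrite big_nil.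
rewrite big_cons; apply: ID; first by apply/IM/SI/sS; rewrite mem_head.
by apply: IH => q qs; apply: sS; rewrite inE qs orbT.
Qed.

Lemma ideal_gen1P a b : ideal_gen [set a] b <-> exists c, b = c * a.
Proof.
split=> [[s sS ->]|[c ->]]; last first.
  by have [_ _] := ideal_gen_ideal [set a]; apply; apply: mem_ideal_gen.
exists (\sum_(p <- s) p.1); rewrite mulr_suml big_seq [RHS]big_seq.
by apply: eq_bigr => p /sS /= ->.
Qed.

Lemma is_ideal_sum I (T : Type) (r : seq T) (P : pred T) (F : T -> R) :
  is_ideal I -> (forall i, P i -> I (F i)) -> I (\sum_(i <- r | P i) F i).
Proof. by case=> I0 ID _ IF; apply: big_ind. Qed.

Lemma is_idealMr I a c : is_ideal I -> I a -> I (a * c).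
Proof. by case=> _ _ IM Ia; rewrite mulrC; apply: IM. Qed.

Lemma is_idealN I a : is_ideal I -> I a -> I (- a).
Proof. by case=> _ _ IM Ia; rewrite -mulN1r; apply: IM. Qed.

Lemma is_idealB I a b : is_ideal I -> I a -> I b -> I (a - b).
Proof. by move=> Ii Ia /(is_idealN Ii); case: Ii => _ ID _; apply: ID. Qed.

End IdealLemmas.

Section PowersOfMaximalIdeal.
Variable k : comNzRingType.
Implicit Types f g h : fps2 k.

(** A series without constant term is x A + y B, where A collects the monomials
    divisible by x and B the pure powers of y; both have order one less. *)
Lemma maxideal_expP n f : ideal_exp (fps2_maxideal k) n f <-> high_order n f.
Proof.
elim: n f => [|n IH] f; first by split.
split.
- apply: ideal_gen_sub.
  + split=> [//|g h|c g]; [exact: high_orderD | exact: high_orderM].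
  + move=> _ [g g0 [h /IH hn <-]] a b ab; rewrite fps2_mulE big1 // => i _.
    rewrite big1 // => j _.
    have [/andP[/eqP i0 /eqP j0]|ij] := boolP ((i == 0%N :> nat) && (j == 0%N :> nat)).
      by rewrite i0 j0 g0 mul0r.
    by rewrite hn ?mulr0 //; move: (leq_ord i) (leq_ord j) ij ab; lia.
- move=> fn; set J := ideal_exp _ _.
  have [_ JD _] : is_ideal J by apply: ideal_gen_ideal.
  have JM g h : g 0%N 0%N = 0 -> high_order n h -> J (g * h).
    by move=> g0 hn; apply: mem_ideal_gen; exists g => //; exists h => //; apply/IH.
  have -> : f = fps2X k * (fun a b => f a.+1 b) +
                fps2Y k * (fun a b => if a == 0%N then f 0%N b.+1 else 0).
    apply: fps2P => -[|i] j; rewrite fps2_addE fps2XE fps2YE !fps2_monomM !mul1r /=.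
      case: j => [|j] /=; first by rewrite fn // addr0.
      by rewrite ?subn1 add0r.
    by rewrite ?subn1 ?subn0 if_same addr0.
  apply: JD; apply: JM; rewrite ?fps2XE ?fps2YE // => a b ab; first exact: fn.
  by case: eqP => // a0; apply: fn; move: ab; rewrite a0; lia.
Qed.

End PowersOfMaximalIdeal.

(** * Substitution of an arc in a power series *)

Section CongruenceOfPolynomials.
Variables (A : comNzRingType) (m : nat).
Implicit Types P Q : {poly A}.

(** Congruence modulo t^(m+1). *)
Definition eqmodt P Q := forall j, (j <= m)%N -> P`_j = Q`_j.

Lemma eqmodt_sym P Q : eqmodt P Q -> eqmodt Q P.
Proof. by move=> PQ j jm; rewrite PQ. Qed.

Lemma eqmodt_trans P Q S : eqmodt P Q -> eqmodt Q S -> eqmodt P S.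
Proof. by move=> PQ QS j jm; rewrite PQ // QS. Qed.

Lemma eqmodtD P P' Q Q' : eqmodt P P' -> eqmodt Q Q' -> eqmodt (P + Q) (P' + Q').
Proof. by move=> PP QQ j jm; rewrite !coefD PP // QQ. Qed.

Lemma eqmodtM P P' Q Q' : eqmodt P P' -> eqmodt Q Q' -> eqmodt (P * Q) (P' * Q').
Proof.
move=> PP QQ j jm; rewrite !coefM; apply: eq_bigr => i _.
by rewrite PP ?QQ // ?(leq_trans (leq_subr _ _)) // (leq_trans (leq_ord i)).
Qed.

Lemma eqmodtX P Q n : eqmodt P Q -> eqmodt (P ^+ n) (Q ^+ n).
Proof.
by move=> PQ; elim: n => [|n IH]; rewrite ?expr0 // !exprS; apply: eqmodtM.
Qed.

Lemma eqmodt_sum (I : Type) (r : seq I) (p : pred I) (F G : I -> {poly A}) :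
  (forall i, p i -> eqmodt (F i) (G i)) ->
  eqmodt (\sum_(i <- r | p i) F i) (\sum_(i <- r | p i) G i).
Proof. by move=> FG j jm; rewrite !coef_sum; apply: eq_bigr => i /FG ->. Qed.

End CongruenceOfPolynomials.

Section ArcEvaluation.
Variables (k A : comNzRingType) (iota : {rmorphism k -> A}) (m : nat).
Variables (X Y : {poly A}).
Hypotheses (X0 : X`_0 = 0) (Y0 : Y`_0 = 0).
Implicit Types (f g : fps2 k) (P Q : {poly {poly k}}).

(** The jet f(X, Y) modulo t^(m+1): as X and Y have no constant term, the
    omitted monomials of f only contribute at higher order. *)
Definition arc_eval f : {poly A} :=
  \sum_(a < m.+1) \sum_(b < m.+1) iota (f a b) *: (X ^+ a * Y ^+ b).

(** Substituting X and Y in a polynomial is a ring morphism, whereas the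
    truncated sum arc_eval is multiplicative only up to order m; its algebraic
    properties are all transported from this morphism by arc_evalP. *)
Definition bipoly_eval : {poly {poly k}} -> {poly A} :=
  horner_eval X \o map_poly (horner_eval Y \o map_poly (polyC \o iota)).

HB.instance Definition _ := GRing.RMorphism.on bipoly_eval.

Lemma bipoly_evalE N P : (size P <= N)%N -> (forall a, (size (P`_a)%R <= N)%N) ->
  bipoly_eval P = \sum_(a < N) \sum_(b < N) iota P`_a`_b *: (X ^+ a * Y ^+ b).
Proof.
move=> PN PaN; rewrite /bipoly_eval.
rewrite -[LHS]/((map_poly (horner_eval Y \o map_poly (polyC \o iota)) P).[X]).
rewrite (horner_coef_wide _ (leq_trans (size_poly _ _) PN)).
apply: eq_bigr => a _; rewrite coef_map.
rewrite -[_ P`_a]/((map_poly (polyC \o iota) P`_a).[Y]).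
rewrite (horner_coef_wide _ (leq_trans (size_poly _ _) (PaN a))).
rewrite mulr_suml; apply: eq_bigr => b _; rewrite coef_map /=.
by rewrite -mul_polyC mulrAC -mulrA.
Qed.

Lemma coef0_exp_lt (Z : {poly A}) a j : Z`_0 = 0 -> (j < a)%N -> (Z ^+ a)`_j = 0.
Proof.
move=> Z0; elim: a j => [//|a IH] j ja; rewrite exprS coefM big1 // => i _.
have [->|i0] := posnP i; first by rewrite Z0 mul0r.
by rewrite IH ?mulr0 //; move: (leq_ord i); lia.
Qed.

Lemma coef_arc_monom a b j : (j < a + b)%N -> (X ^+ a * Y ^+ b)`_j = 0.
Proof.
move=> jab; rewrite coefM big1 // => i _.
have [ia|ai] := ltnP i a; first by rewrite (coef0_exp_lt X0) ?mul0r.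
by rewrite (coef0_exp_lt Y0) ?mulr0 //; move: (leq_ord i); lia.
Qed.

Lemma bipoly_eval_high P : (forall a b, (a + b <= m)%N -> P`_a`_b = 0) ->
  eqmodt m (bipoly_eval P) 0.
Proof.
move=> Pm j jm; pose N := maxn (size P) (\max_(a < size P) size (P`_a)%R).
rewrite (@bipoly_evalE N); last first.
- move=> a; have [aP|Pa] := ltnP a (size P); last by rewrite nth_default // size_poly0.
  by rewrite leq_max (leq_bigmax (Ordinal aP)) orbT.
- exact: leq_maxl.
rewrite coef_sum coef0 big1 // => a _; rewrite coef_sum big1 // => b _.
rewrite coefZ; have [ab|ab] := leqP (a + b) m; first by rewrite Pm // rmorph0 mul0r.
by rewrite coef_arc_monom ?mulr0 // (leq_ltn_trans jm).
Qed.

(** Only the coefficients of total degree at most m matter, so f can be replaced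
    by any polynomial that agrees with it there. *)
Lemma arc_evalP P f : (forall a b, (a + b <= m)%N -> P`_a`_b = f a b) ->
  eqmodt m (arc_eval f) (bipoly_eval P).
Proof.
move=> Pf; pose T : {poly {poly k}} := \poly_(a < m.+1) \poly_(b < m.+1) f a b.
have -> : arc_eval f = bipoly_eval T.
  rewrite (@bipoly_evalE m.+1) ?size_poly //; last first.
    by move=> a; rewrite coef_poly; case: ifP; rewrite ?size_poly0 ?size_poly.
  by apply: eq_bigr => a _; apply: eq_bigr => b _; rewrite !coef_poly !ltn_ord coef_poly ltn_ord.
have -> : bipoly_eval T = bipoly_eval P + bipoly_eval (T - P).
  by rewrite rmorphB addrC subrK.
rewrite -[X in eqmodt _ _ X]addr0; apply: eqmodtD => //; apply: bipoly_eval_high.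
move=> a b ab; rewrite coefB coefB Pf // coef_poly ifT; last by lia.
by rewrite coef_poly ifT ?subrr //; lia.
Qed.

Definition fps2_trunc f : {poly {poly k}} :=
  \poly_(a < m.+1) \poly_(b < m.+1) f a b.

Lemma coef_fps2_trunc f a b : (a <= m)%N -> (b <= m)%N -> (fps2_trunc f)`_a`_b = f a b.
Proof. by move=> am bm; rewrite coef_poly ltnS am coef_poly ltnS bm. Qed.

Lemma arc_evalT f : eqmodt m (arc_eval f) (bipoly_eval (fps2_trunc f)).
Proof. by apply: arc_evalP => a b ab; apply: coef_fps2_trunc; lia. Qed.

Lemma arc_evalD f g : eqmodt m (arc_eval (f + g)) (arc_eval f + arc_eval g).
Proof.
apply: eqmodt_trans (eqmodt_sym (eqmodtD (arc_evalT f) (arc_evalT g))).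
rewrite -rmorphD; apply: arc_evalP => a b ab.
by rewrite !coefD !coef_fps2_trunc //; lia.
Qed.

Lemma arc_evalM f g : eqmodt m (arc_eval (f * g)) (arc_eval f * arc_eval g).
Proof.
apply: eqmodt_trans (eqmodt_sym (eqmodtM (arc_evalT f) (arc_evalT g))).
rewrite -rmorphM; apply: arc_evalP => a b ab.
rewrite coefM coef_sum fps2_mulE; apply: eq_bigr => i _.
rewrite coefM; apply: eq_bigr => j _; move: (leq_ord i) (leq_ord j) => ia jb.
by rewrite !coef_fps2_trunc //; lia.
Qed.

Lemma arc_eval_high f : high_order m.+1 f -> eqmodt m (arc_eval f) 0.
Proof.
move=> fm; apply: eqmodt_trans (@bipoly_eval_high 0 _).
  by apply: arc_evalP => a b ab; rewrite !coef0 fm.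
by move=> a b _; rewrite !coef0.
Qed.

Lemma arc_eval_monom c a b :
  eqmodt m (arc_eval (fps2_monom c a b)) (iota c *: (X ^+ a * Y ^+ b)).
Proof.
pose E1 := horner_eval Y \o map_poly (polyC \o iota).
have E1C : forall q, bipoly_eval q%:P = E1 q.
  by move=> q; rewrite -[LHS]/((map_poly E1 q%:P).[X]) map_polyC hornerC.
have EX : bipoly_eval 'X = X.
  by rewrite -[LHS]/((map_poly E1 'X).[X]) map_polyX hornerX.
have EY : bipoly_eval 'X%:P = Y.
  by rewrite E1C -[LHS]/((map_poly (polyC \o iota) 'X).[Y]) map_polyX hornerX.
have EC : bipoly_eval c%:P%:P = (iota c)%:P.
  by rewrite E1C -[LHS]/((map_poly (polyC \o iota) c%:P).[Y]) map_polyC hornerC.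
have -> : iota c *: (X ^+ a * Y ^+ b) = bipoly_eval (c%:P%:P * ('X ^+ a * 'X%:P ^+ b)).
  by rewrite !rmorphM !rmorphXn /= EX EY EC mul_polyC.
apply: arc_evalP => i j _; rewrite coefCM -rmorphXn coefMC coefXn /fps2_monom.
case: eqP => _ /=; last by rewrite mul0r mulr0 coef0.
by rewrite mul1r coefCM coefXn; case: eqP; rewrite ?mulr1 ?mulr0.
Qed.

End ArcEvaluation.

(** * Jets as values on arcs; division by a binomial; the generic line *)

Section JetsAndArcs.
Variables (k : comNzRingType) (m : nat).
Implicit Types (f g h : fps2 k) (I : set (fps2 k)).

Lemma jetDE j f :
  jetD m j f = (arc_eval (@mpolyC (m + m) k) m (arcX k m) (arcY k m) f)`_j.
Proof. by []. Qed.

Lemma coef_truncated_arc (A : comNzRingType) (u : 'I_m -> A) (v : nat -> A) :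
  (forall i : 'I_m, u i = v i) -> forall j, (j <= m)%N ->
  (\sum_(i < m) u i *: 'X^(i.+1))`_j = if j is i.+1 then v i else 0.
Proof.
move=> uv j jm; rewrite coef_sum; case: j jm => [|j] jm.
  by rewrite big1 // => i _; rewrite coefZ coefXn mulr0.
rewrite (bigD1 (Ordinal jm)) //= coefZ coefXn eqxx mulr1 uv big1 ?addr0 // => i ij.
rewrite coefZ coefXn eqSS; case: eqP => [E|_]; last by rewrite mulr0.
by case/eqP: ij; apply: val_inj.
Qed.

Lemma arcX0 : (arcX k m)`_0 = 0.
Proof. by rewrite coef_sum big1 // => i _; rewrite coefZ coefXn mulr0. Qed.

Lemma arcY0 : (arcY k m)`_0 = 0.
Proof. by rewrite coef_sum big1 // => i _; rewrite coefZ coefXn mulr0. Qed.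

Lemma jetD_add j f g : (j <= m)%N -> jetD m j (f + g) = jetD m j f + jetD m j g.
Proof. by move=> jm; rewrite !jetDE (arc_evalD _ arcX0 arcY0) // coefD. Qed.

Lemma jetD_high j f : high_order m.+1 f -> (j <= m)%N -> jetD m j f = 0.
Proof. by move=> fm jm; rewrite jetDE (arc_eval_high _ arcX0 arcY0 fm) // coef0. Qed.

Lemma jet_ideal_jetD I j f : (j <= m)%N -> I f -> jet_ideal I (jetD m j f).
Proof. by move=> jm If; apply: mem_ideal_gen; exists j, f. Qed.

Lemma jet_closure_sub I f : I f -> jet_closure m I f.
Proof. by move=> If j jm; apply: jet_ideal_jetD. Qed.

Section EvaluationOfJets.
Variables (A : comNzRingType) (iota : {rmorphism k -> A}) (X Y : {poly A}).
Hypotheses (X0 : X`_0 = 0) (Y0 : Y`_0 = 0).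

(** The point of the jet scheme given by the arc (X, Y). *)
Definition jet_point : jet_ring k m -> A :=
  mmap iota (fun i => match split i with inl a => X`_a.+1 | inr b => Y`_b.+1 end).

HB.instance Definition _ := GRing.RMorphism.on jet_point.

Lemma jet_pointX i :
  jet_point 'X_i = match split i with inl a => X`_a.+1 | inr b => Y`_b.+1 end.
Proof. by rewrite /jet_point mmapX mmap1U. Qed.

Lemma jet_point_jetD j f : (j <= m)%N ->
  jet_point (jetD m j f) = (arc_eval iota m X Y f)`_j.
Proof.
move=> jm; rewrite jetDE -coef_map /arc_eval rmorph_sum /=.
have EX : eqmodt m (map_poly jet_point (arcX k m)) X.
  rewrite /arcX rmorph_sum /= => i im.
  have -> : \sum_(a < m) map_poly jet_point ('X_(lshift m a) *: 'X^(a.+1)) =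
            \sum_(a < m) X`_a.+1 *: 'X^(a.+1).
    apply: eq_bigr => a _; rewrite map_polyZ map_polyXn /= jet_pointX.
    by rewrite -[lshift m a]/(unsplit (inl a)) unsplitK.
  by rewrite (@coef_truncated_arc _ _ (fun i => X`_i.+1)) //; case: i im.
have EY : eqmodt m (map_poly jet_point (arcY k m)) Y.
  rewrite /arcY rmorph_sum /= => i im.
  have -> : \sum_(a < m) map_poly jet_point ('X_(rshift m a) *: 'X^(a.+1)) =
            \sum_(a < m) Y`_a.+1 *: 'X^(a.+1).
    apply: eq_bigr => a _; rewrite map_polyZ map_polyXn /= jet_pointX.
    by rewrite -[rshift m a]/(unsplit (inr a)) unsplitK.
  by rewrite (@coef_truncated_arc _ _ (fun i => Y`_i.+1)) //; case: i im.
move: j jm; apply: eqmodt_sum => a _; rewrite rmorph_sum; apply: eqmodt_sum => b _.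
rewrite /= map_polyZ /= rmorphM !rmorphXn /= [jet_point _]mmapC -!mul_polyC.
by apply: eqmodtM => //; apply: eqmodtM; apply: eqmodtX.
Qed.

(** D_j(h g) is a combination of the D_i(g) with i <= j, so the generators of the
    jet ideal of (g) all take values in J; hence so does every D_j(f). This turns
    each arc on which g is small into an obstruction to f being in the closure. *)
Lemma jet_closure_arc (J : set A) g f : is_ideal J ->
  (forall j, (j <= m)%N -> J (arc_eval iota m X Y g)`_j) ->
  jet_closure m (ideal_gen [set g]) f ->
  forall j, (j <= m)%N -> J (arc_eval iota m X Y f)`_j.
Proof.
move=> Ji Jg fI j jm; rewrite -jet_point_jetD //.
apply: (ideal_gen_sub (I := [set p | J (jet_point p)])) (fI j jm).
  case: Ji => J0 JD JM; split=> /= [|a b Ja Jb|c a Ja]; rewrite ?rmorph0 //.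
    by rewrite rmorphD; apply: JD.
  by rewrite rmorphM; apply: JM.
move=> _ [i [_ [im /ideal_gen1P[h ->] ->]]] /=; rewrite jet_point_jetD //.
rewrite (arc_evalM _ X0 Y0) // coefM; apply: is_ideal_sum => // a _.
by case: Ji => _ _ JM; apply: JM; apply: Jg; apply: leq_trans (leq_subr _ _) im.
Qed.

End EvaluationOfJets.
End JetsAndArcs.

Section Binomials.
Variable k : comNzRingType.
Implicit Types (f g h : fps2 k).

Lemma arc_eval_binomial (A : comNzRingType) (iota : {rmorphism k -> A}) m
    (X Y : {poly A}) p q p' q' : X`_0 = 0 -> Y`_0 = 0 ->
  eqmodt m (arc_eval iota m X Y (fps2_monom 1 p q + fps2_monom 1 p' q'))
           (X ^+ p * Y ^+ q + X ^+ p' * Y ^+ q').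
Proof.
move=> X0 Y0; apply: eqmodt_trans (arc_evalD _ X0 Y0 _ _) _.
by apply: eqmodtD => j jm; rewrite arc_eval_monom // rmorph1 scale1r.
Qed.

Section Division.
Variables (l w q s : nat) (f : fps2 k).

(** The quotient h of f by g = x^(l+w+1) y^q + x^l y^(q+s) solves
    h_(a,b) + h_(a+w+1,b-s) = f_(a+l+w+1,b+q), a recursion on b since s > 0;
    n is the fuel. *)
Fixpoint binomial_quo n : fps2 k := fun a b =>
  if n is n'.+1 then
    f (a + (l + w.+1))%N (b + q)%N -
      (if (s <= b)%N then binomial_quo n' (a + w.+1)%N (b - s)%N else 0)
  else 0.

Lemma binomial_quoE n n' a b : (0 < s)%N -> (b < n)%N -> (b < n')%N ->
  binomial_quo n a b = binomial_quo n' a b.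
Proof.
move=> s0; elim: n n' a b => [//|n IH] [//|n'] a b bn bn' /=.
by case: leqP => // sb; rewrite (IH n') //; lia.
Qed.

Lemma binomial_division : (0 < s)%N -> exists h : fps2 k, forall a b,
  (f - h * (fps2_monom 1 (l + w.+1) q + fps2_monom 1 l (q + s)))
    (a + (l + w.+1))%N (b + q)%N = 0.
Proof.
move=> s0; exists (fun a b => binomial_quo b.+1 a b) => a b.
set h := (fun _ _ => _); rewrite fps2_addE fps2_oppE mulrC mulrDl fps2_addE.
rewrite !fps2_monomM !mul1r !leq_addl /= !addnK.
have -> : (l <= a + (l + w.+1))%N by lia.
have -> : (a + (l + w.+1) - l = a + w.+1)%N by lia.
have -> : (q + s <= b + q)%N = (s <= b)%N by lia.
have -> : (b + q - (q + s) = b - s)%N by lia.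
rewrite /h.
have -> : binomial_quo b.+1 a b = f (a + (l + w.+1))%N (b + q)%N -
  (if (s <= b)%N then binomial_quo b (a + w.+1)%N (b - s)%N else 0) by [].
case: leqP => sb; last by rewrite subr0 addr0 subrr.
by rewrite (@binomial_quoE (b - s).+1 b) ?subrK ?subrr //; lia.
Qed.
End Division.

(** The series supported outside a set closed under division of monomials form
    a monomial ideal. *)
Lemma vanishing_ideal (S : nat -> nat -> bool) :
  (forall a b a' b', (a' <= a)%N -> (b' <= b)%N -> S a b -> S a' b') ->
  is_ideal [set F : fps2 k | forall a b, S a b -> F a b = 0].
Proof.
move=> Sdown; split=> [//|F G F0 G0 a b Sab|F G G0 a b Sab] /=.
  by rewrite fps2_addE F0 // G0 // addr0.
rewrite fps2_mulE big1 // => i _; rewrite big1 // => j _.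
by rewrite G0 ?mulr0 //; apply: Sdown Sab; apply: leq_subr.
Qed.

(** The generic line (u t, v t) through the origin, along which the coefficient
    of t^j in f is the homogeneous part of f of degree j. *)
Definition lineX : {poly fps2 k} := fps2X k *: 'X.
Definition lineY : {poly fps2 k} := fps2Y k *: 'X.

Lemma lineX0 : lineX`_0 = 0. Proof. by rewrite coefZ coefX mulr0. Qed.
Lemma lineY0 : lineY`_0 = 0. Proof. by rewrite coefZ coefX mulr0. Qed.

Lemma line_monom a b : lineX ^+ a * lineY ^+ b = fps2_monom 1 a b *: 'X^(a + b).
Proof.
by rewrite !exprZn -scalerAl -scalerAr scalerA fps2_XY -exprD.
Qed.

Lemma fps2_sumE (I : Type) (r : seq I) (P : pred I) (F : I -> fps2 k) a b :
  (\sum_(i <- r | P i) F i) a b = \sum_(i <- r | P i) F i a b.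
Proof. by apply: (big_morph (fun f : fps2 k => f a b)). Qed.

Lemma arc_eval_line m f a b : (a + b <= m)%N ->
  (arc_eval (@fps2C k) m lineX lineY f)`_(a + b) a b = f a b.
Proof.
move=> abm; rewrite coef_sum fps2_sumE.
have am : (a < m.+1)%N by lia.
have bm : (b < m.+1)%N by lia.
pose F (i j : 'I_m.+1) := fps2_monom (f i j) i j a b.
transitivity (\sum_i \sum_j F i j).
  apply: eq_bigr => i _; rewrite coef_sum fps2_sumE; apply: eq_bigr => j _.
  rewrite line_monom scalerA coefZ coefXn fps2C_monom mulr1 /F /fps2_monom.
  case: eqP => [E|nE]; first by rewrite mulr1.
  rewrite mulr0 fps2_zeroE; case: ifP => // /andP[/eqP ai /eqP bj].
  by case: nE; rewrite ai bj.
rewrite (bigD1 (Ordinal am)) //= (bigD1 (Ordinal bm)) //= /F /fps2_monom !eqxx /=.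
rewrite !big1 ?addr0 // => [i ia | j jb].
  by rewrite big1 // => j _; case: eqP => //= E; case/eqP: ia; apply: val_inj.
by case: eqP => //= E; case/eqP: jb; apply: val_inj.
Qed.

(** Along the generic line, each D_j(g) is a sum of monomials of g, so the
    homogeneous parts of f up to degree m lie in the ideal of these monomials. *)
Lemma jet_closure_initial m p q p' q' f a b :
  jet_closure m (ideal_gen [set fps2_monom 1 p q + fps2_monom 1 p' q']) f ->
  (a + b <= m)%N -> ~~ ((p <= a) && (q <= b))%N -> ~~ ((p' <= a) && (q' <= b))%N ->
  f a b = 0.
Proof.
move=> fI abm pq pq'.
pose S a b := ~~ ((p <= a) && (q <= b))%N && ~~ ((p' <= a) && (q' <= b))%N.
have Si : is_ideal [set F : fps2 k | forall a b, S a b -> F a b = 0].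
  by apply: vanishing_ideal; rewrite /S => i j i' j' ii jj; move: i j i' j' ii jj; lia.
rewrite -(arc_eval_line f abm).
apply: (jet_closure_arc lineX0 lineY0 Si _ fI abm); last by rewrite /S pq pq'.
move=> j jm /= i i' Sii; rewrite arc_eval_binomial ?lineX0 ?lineY0 //.
rewrite !line_monom coefD !coefZ !coefXn fps2_addE.
rewrite !fps2_monomM !ifF ?addr0 //; move: Sii; rewrite /S; lia.
Qed.
End Binomials.

(** * Arcs with two terms *)

Section TwoTermArc.
Variables (A : comNzRingType) (al be y : A) (d : nat).

(** These arcs are chosen so that, in X^p Y^q, the first two terms in t are
    al^p y^q t^(p+q) and p al^(p-1) be y^q t^(p+q+d), the next one being of order
    p + q + 2 d. The first will lie in J, the second cancels another monomial. *)
Definition twotermX : {poly A} := al *: 'X + be *: 'X^(d.+1).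
Definition twotermY : {poly A} := y *: 'X.

Lemma twotermX0 : twotermX`_0 = 0.
Proof. by rewrite coefD !coefZ coefX coefXn !mulr0 addr0. Qed.

Lemma twotermY0 : twotermY`_0 = 0.
Proof. by rewrite coefZ coefX mulr0. Qed.

Lemma exprD_second_order (R : comNzRingType) (a b : R) n : exists c,
  (a + b) ^+ n.+1 = a ^+ n.+1 + n.+1%:R * a ^+ n * b + c * b ^+ 2.
Proof.
elim: n => [|n [c IH]]; first by exists 0; rewrite !expr1 expr0; ring.
exists (n.+1%:R * a ^+ n + (a + b) * c).
by rewrite [LHS]exprS IH [in LHS]exprS [a ^+ n.+2]exprS [a ^+ n.+1]exprS; ring.
Qed.

Lemma twoterm_pow n : (0 < d)%N ->
  eqmodt d ((al%:P + be *: 'X^d) ^+ n.+1)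
           ((al ^+ n.+1)%:P + (al ^+ n * be *+ n.+1) *: 'X^d).
Proof.
move=> d0 j jd; have [c ->] := exprD_second_order al%:P (be *: 'X^d) n.
have c0 : (c * (be *: 'X^d) ^+ 2)`_j = 0.
  by rewrite exprZn -exprM -scalerAr coefZ coefMXn ifT ?mulr0 //; lia.
have E : n.+1%:R * al%:P ^+ n * (be *: 'X^d) = (al ^+ n * be *+ n.+1) *: 'X^d.
  by rewrite -mulrA mulr_natl -!mul_polyC polyCMn polyCM rmorphXn mulrnAl -!mulrA.
by rewrite [LHS]coefD [X in _ + X]c0 addr0 E rmorphXn.
Qed.

Lemma coef_twoterm_monom a b j : (0 < d)%N -> (j <= a.+1 + b + d)%N ->
  (twotermX ^+ a.+1 * twotermY ^+ b)`_j =
    y ^+ b * (al ^+ a.+1 *+ (j == a.+1 + b)%N + al ^+ a * be *+ a.+1 *+ (j == a.+1 + b + d)%N).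
Proof.
move=> d0 jm.
have -> : twotermX = (al%:P + be *: 'X^d) * 'X.
  by rewrite mulrDl mul_polyC -scalerAl -exprSr.
rewrite exprMn exprZn -mulrA -scalerAr -exprD -scalerAr coefZ coefMXn.
case: ltnP => jab; first by rewrite !ltn_eqF ?mulr0n ?addr0 ?mulr0 //; lia.
rewrite twoterm_pow //; last by lia.
rewrite coefD coefC coefZ coefXn.
have -> : (j - (a.+1 + b) == 0)%N = (j == a.+1 + b)%N by lia.
have -> : (j - (a.+1 + b) == d)%N = (j == a.+1 + b + d)%N by lia.
by case: (j == _)%N; case: (j == _)%N; rewrite ?mulr1n ?mulr0n ?mulr1 ?mulr0.
Qed.

Lemma coef_twoterm_low a b j : (0 < d)%N -> (j <= a + b)%N ->
  (twotermX ^+ a * twotermY ^+ b)`_j = (al ^+ a * y ^+ b) *+ (j == a + b)%N.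
Proof.
case: a => [|a] d0 jm.
  by rewrite !expr0 !mul1r exprZn coefZ coefXn add0n mulr_natr.
rewrite coef_twoterm_monom //; last by lia.
have -> : (j == a.+1 + b + d)%N = false by lia.
by rewrite mulr0n addr0 mulrnAr mulrC.
Qed.

End TwoTermArc.

(** * The coefficient of the second monomial of a binomial *)

Section CriticalMonomial.
Variable k : comNzRingType.
Implicit Types (f g h : fps2 k).

Lemma arc_eval_single (A : comNzRingType) (iota : {rmorphism k -> A}) m
    (X Y : {poly A}) f p q : X`_0 = 0 -> Y`_0 = 0 ->
  (forall a b, (a + b <= m)%N -> ~~ ((a == p) && (b == q)) -> f a b = 0) ->
  eqmodt m (arc_eval iota m X Y f) (iota (f p q) *: (X ^+ p * Y ^+ q)).
Proof.
move=> X0 Y0 f0; pose r := f - fps2_monom (f p q) p q.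
have -> : f = fps2_monom (f p q) p q + r by rewrite addrC subrK.
rewrite [in iota _]fps2_addE {2}/fps2_monom !eqxx /= [r p q]fps2_addE fps2_oppE.
rewrite {2}/fps2_monom !eqxx subrr addr0.
apply: eqmodt_trans (arc_evalD _ X0 Y0 _ _) _; rewrite -[X in eqmodt _ _ X]addr0.
apply: eqmodtD; first exact: arc_eval_monom.
apply: arc_eval_high => // a b; rewrite ltnS /r fps2_addE fps2_oppE /fps2_monom.
by case: ifPn => [/andP[/eqP -> /eqP ->] | ab] abm; rewrite ?subrr // f0 ?subr0.
Qed.

(** With s = w + 1 + d, the arc X = u^s t + c v^s t^(d+1), Y = u^w v t has
    X^p Y^q = u^N v^q t^(p+q) + p c M t^m + ... and X^l Y^(q+s) = M t^m + ...
    for p = l + w + 1, N = s p + w q and M = u^(s l + w (q+s)) v^(q+s). As p c = -1,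
    only u^N v^q remains of g up to order m, but M is not divisible by u^N. *)
Lemma critical_coef0_inhomogeneous l w q d c f :
  let m := (l + w.+1 + q + d)%N in
  (l + w.+1)%:R * c = -1 :> k -> (0 < d)%N ->
  jet_closure m (ideal_gen [set fps2_monom 1 (l + w.+1) q +
                                fps2_monom 1 l (q + (w.+1 + d))]) f ->
  (forall a b, (a + b <= m)%N -> ~~ ((a == l) && (b == q + (w.+1 + d)))%N ->
     f a b = 0) ->
  f l (q + (w.+1 + d))%N = 0.
Proof.
move=> m pc d0 fI f0; set s := (w.+1 + d)%N in fI f0 *.
pose al : fps2 k := fps2_monom 1 s 0; pose be : fps2 k := fps2_monom c 0 s.
pose y : fps2 k := fps2_monom 1 w 1; pose N := (s * (l + w.+1) + w * q)%N.
have X0 := twotermX0 al be d; have Y0 := twotermY0 y.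
have Ji : is_ideal [set F : fps2 k | forall a b, (a < N)%N -> F a b = 0].
  by apply: (@vanishing_ideal k (fun a b => (a < N)%N)) => a b a' b' aa _; apply: leq_ltn_trans.
have Jg : forall j, (j <= m)%N -> [set F : fps2 k | forall a b, (a < N)%N -> F a b = 0]
    (arc_eval (@fps2C k) m (twotermX al be d) (twotermY y)
       (fps2_monom 1 (l + w.+1) q + fps2_monom 1 l (q + s)))`_j.
  move=> j jm; rewrite (arc_eval_binomial _ _ _ _ _ X0 Y0) // coefD.
  rewrite [(l + w.+1)%N]addnS coef_twoterm_monom //; last by move: jm; rewrite /m; lia.
  rewrite coef_twoterm_low //; last by rewrite /s; move: jm; rewrite /m; lia.
  have -> : (l + (q + s) = (l + w).+1 + q + d)%N by rewrite /s; lia.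
  case: (eqVneq j ((l + w).+1 + q + d)%N) => [->|jm'] a b aN /=.
    have -> : ((l + w).+1 + q + d == (l + w).+1 + q)%N = false by lia.
    rewrite mulr0n mulr1n add0r mulr1n -mulr_natl.
    rewrite -(rmorph_nat (@fps2C k)) /= /al /be /y.
    rewrite !fps2_monomX !fps2_monomMM !expr1n fps2_addE.
    have -> : (q * w + (0 + ((l + w) * s + 0)) = l * s + (q + s) * w)%N by lia.
    have -> : (q * 1 + (0 + ((l + w) * 0 + s)) = l * 0 + (q + s) * 1)%N by lia.
    rewrite -addnS !mul1r pc /fps2_monom.
    by case: ifP; rewrite ?addNr ?addr0.
  rewrite !mulr0n !addr0 mulrnAr; case: eqP => _; rewrite ?mulr0n ?mulr1n //.
  rewrite /al /y !fps2_monomX fps2_monomMM /fps2_monom ifF //.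
  by move: aN; rewrite /N; nia.
have := jet_closure_arc (iota := @fps2C k) X0 Y0 Ji Jg fI (leqnn m).
rewrite (arc_eval_single _ X0 Y0 f0) // coefZ coef_twoterm_low //; last by rewrite /m /s; lia.
have -> : (m == l + (q + s))%N by rewrite /m /s; lia.
rewrite mulr1n /al /y !fps2_monomX fps2_monomMM fps2C_monom !expr1n !mulr1.
move/(_ (l * s + (q + s) * w)%N (q + s)%N); rewrite /fps2_monom muln0 muln1 !eqxx /=.
by apply; rewrite /N /s; nia.
Qed.

(** Here g is homogeneous of degree m, so the part of f of degree m must be a
    multiple of g; being supported on a single monomial, it vanishes. *)
Lemma critical_coef0_homogeneous l w q f :
  let m := (l + w.+1 + q)%N in
  jet_closure m (ideal_gen [set fps2_monom 1 (l + w.+1) q +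
                                fps2_monom 1 l (q + w.+1)]) f ->
  (forall a b, (a + b <= m)%N -> ~~ ((a == l) && (b == q + w.+1))%N -> f a b = 0) ->
  f l (q + w.+1)%N = 0.
Proof.
move=> m; set g := _ + _ => fI f0.
have Jg : forall j, (j <= m)%N ->
    ideal_gen [set g] (arc_eval (@fps2C k) m (lineX k) (lineY k) g)`_j.
  move=> j jm; rewrite (arc_eval_binomial _ _ _ _ _ (lineX0 k) (lineY0 k)) //.
  rewrite !line_monom [(l + (q + _))%N](_ : _ = m); last by rewrite /m; lia.
  rewrite -scalerDl -/g coefZ; apply: is_idealMr; first exact: ideal_gen_ideal.
  exact: mem_ideal_gen.
have := jet_closure_arc (iota := @fps2C k) (lineX0 k) (lineY0 k)
  (ideal_gen_ideal [set g]) Jg fI (leqnn m).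
rewrite (arc_eval_single _ (lineX0 k) (lineY0 k) f0) // line_monom scalerA coefZ coefXn.
rewrite [(l + (q + _))%N](_ : _ = m); last by rewrite /m; lia.
rewrite eqxx mulr1 fps2C_monom mulr1 => /ideal_gen1P[h E].
(* The coefficient of x^p y^q in h g gives the constant term of h, which the
   coefficient of x^l y^(q+s) then identifies with that of f. *)
have : h 0%N 0%N = 0.
  move/(congr1 (fun F : fps2 k => F (l + w.+1)%N q)): E.
  rewrite mulrC mulrDl fps2_addE !fps2_monomM !mul1r !leqnn /= !subnn /fps2_monom.
  have -> : (q == q + w.+1)%N = false by lia.
  have -> : (q + w.+1 <= q)%N = false by lia.
  by rewrite !andbF addr0.
move/(congr1 (fun F : fps2 k => F l (q + w.+1)%N)): E.
rewrite mulrC mulrDl fps2_addE !fps2_monomM !mul1r !leqnn /= !subnn /fps2_monom !eqxx /=.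
have -> : (l + w.+1 <= l)%N = false by lia.
by rewrite add0r => -> ->.
Qed.

End CriticalMonomial.

(** * Jet closures of binomials *)

Section ClosureIsIdeal.
Variables (k : comNzRingType) (m : nat) (I : set (fps2 k)).

Lemma jet_closure_ideal : is_ideal (jet_closure m I).
Proof.
have Ji : is_ideal (@jet_ideal k m I) by apply: ideal_gen_ideal.
have [J0 JD JM] := Ji; split.
- by move=> j jm; rewrite jetD_high.
- by move=> f g fI gI j jm; rewrite jetD_add //; apply: JD; [apply: fI | apply: gI].
- move=> h f fI j jm; rewrite jetDE (arc_evalM _ (arcX0 k m) (arcY0 k m)) // coefM.
  by apply: is_ideal_sum => // i _; apply: JM; apply: fI; apply: leq_trans (leq_subr _ _) jm.
Qed.

Lemma jet_closure_high f : high_order m.+1 f -> jet_closure m I f.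
Proof.
move=> fm j jm; rewrite jetD_high //.
by have [] : is_ideal (@jet_ideal k m I) by apply: ideal_gen_ideal.
Qed.

Lemma sub_jet_closure : ideal_add I (ideal_exp (fps2_maxideal k) m.+1) `<=` jet_closure m I.
Proof.
have [_ CD _] := jet_closure_ideal.
move=> _ [f If [g /maxideal_expP gm <-]]; apply: CD; first exact: jet_closure_sub.
exact: jet_closure_high.
Qed.

End ClosureIsIdeal.

Section BinomialClosure.
Variable k : fieldType.
Hypothesis char0 : [pchar k] =i pred0.

Lemma natr_neq0 n : n.+1%:R != 0 :> k.
Proof. by move/pcharf0P: char0 => ->. Qed.

(** The condition s > w says that the second monomial of g has at least the
    degree of the first one, and m is at most the degree of the second. *)
Theorem binomial_jet_closure l w q s m :
  let I := ideal_gen [set fps2X k ^+ (l + w.+1) * fps2Y k ^+ q +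
                          fps2X k ^+ l * fps2Y k ^+ (q + s)] in
  (w < s)%N -> (m <= l + q + s)%N ->
  jet_closure m I = ideal_add I (ideal_exp (fps2_maxideal k) m.+1).
Proof.
rewrite !fps2_XY; set g := _ + _ => I ws ms.
apply/seteqP; split; last exact: sub_jet_closure.
move=> f fI; have [h hf] := binomial_division l w q f (leq_ltn_trans (leq0n w) ws).
pose r := f - h * g; have Ihg : I (h * g) by apply/ideal_gen1P; exists h.
exists (h * g) => //; exists r; last by rewrite addrC subrK.
apply/maxideal_expP; have rI : jet_closure m I r.
  by apply: (is_idealB (jet_closure_ideal m I)) => //; apply: jet_closure_sub.
have r0 a b : (a + b <= m)%N -> ~~ ((a == l) && (b == q + s))%N -> r a b = 0.
  move=> abm ab; have [/andP[pa qb]|pq] := boolP ((l + w.+1 <= a) && (q <= b))%N.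
    by rewrite -(subnK pa) -(subnK qb); apply: hf.
  by apply: (jet_closure_initial rI) => //; move: ab abm ms; lia.
move=> a b; rewrite ltnS => abm.
have [/andP[/eqP al /eqP bl]|] := boolP ((a == l) && (b == q + s))%N; last exact: r0.
rewrite al bl in abm *; have mE : (m = l + w.+1 + q + (s - w.+1))%N by lia.
have sE : (s = w.+1 + (s - w.+1))%N by lia.
have [d0|d0] := posnP (s - w.+1); last first.
  pose c : k := - (l + w.+1)%:R^-1.
  rewrite sE; apply: (critical_coef0_inhomogeneous (c := c) (d := s - w.+1)) => //.
  - by rewrite /c mulrN mulfV // addnS natr_neq0.
  - by rewrite -mE -sE.
  - by rewrite -mE -sE.
rewrite d0 addn0 in mE; have {}sE : s = w.+1 by lia.
rewrite sE; apply: critical_coef0_homogeneous.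
- by rewrite -mE; move: rI; rewrite /I /g sE.
- by rewrite -mE -sE.
Qed.

(** Compare the coefficients of t^(n+3) in X S' = 2 S X', where S = X^2: modulo J,
    the left one is (n + 3) X_1 S_(n+3) and the right one 2 S_(n+3) X_1. *)
Lemma square_leading_coef (A : comNzRingType) (J : set A) (X : {poly A}) n :
  is_ideal J -> X`_0 = 0 -> (forall j, (j < n.+3)%N -> J (X ^+ 2)`_j) ->
  J (X`_1 * (X ^+ 2)`_n.+3 *+ n.+1).
Proof.
move=> Ji X0 JS; set S := X ^+ 2 in JS *; have [J0 JD JM] := Ji.
have JMn z i : J z -> J (z *+ i) by rewrite -mulr_natl; apply: JM.
have E : X * S^`() = S * X^`() *+ 2 by rewrite /S expr2 derivM; ring.
have H1 : J ((X * S^`())`_n.+3 - X`_1 * S`_n.+3 *+ n.+3).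
  rewrite coefM big_ord_recl big_ord_recl /= X0 mul0r add0r subn1 coef_deriv /=.
  rewrite -mulrnAr addrAC subrr add0r; apply: is_ideal_sum => // i _; apply: JM.
  rewrite coef_deriv; apply: JMn; apply: JS; rewrite /bump /=; lia.
have H2 : J ((S * X^`() *+ 2)`_n.+3 - X`_1 * S`_n.+3 *+ 2).
  rewrite coefMn -mulrnBl; apply: JMn.
  rewrite coefM big_ord_recr /= subnn coef_deriv mulr1n [S`_n.+3 * _]mulrC addrK.
  by apply: is_ideal_sum => // i _; apply: is_idealMr => //; apply: JS.
rewrite E in H1; have := is_idealB Ji H2 H1; rewrite opprB addrC addrA subrK.
rewrite -[n.+3]/(2 + n.+1)%N mulrnDr addrC addrA addNr add0r.
done.
Qed.

(** * The first order beyond the degree of x^2 + y^n *)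

Section NextOrder.
(* Writing the exponent n >= 3 of y as d + 2 makes the arc X = al t + be t^(n-1)
   a two-term arc of gap d. *)
Variable d : nat.
Hypothesis d0 : (0 < d)%N.
Let n := d.+2.
Let m := n.+1.
Let g : fps2 k := fps2_monom 1 2 0 + fps2_monom 1 0 n.
Let I := ideal_gen [set g].

(** In the universal arc, Y^n has order at least n, so X^2 has its coefficients of
    order less than n in the jet ideal. *)
Lemma cube_in_jet_closure : jet_closure m I (fps2_monom 1 3 0).
Proof.
set J := @jet_ideal k m I; have Ji : is_ideal J by apply: ideal_gen_ideal.
have [J0 JD JM] := Ji; have X0 := arcX0 k m; have Y0 := arcY0 k m.
set X := arcX k m in X0; set Y := arcY k m in Y0; pose S := X ^+ 2.
have GS : eqmodt m (arc_eval (@mpolyC _ k) m X Y g) (S + Y ^+ n).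
  by move=> j jm; rewrite arc_eval_binomial // !expr0 mulr1 mul1r.
have JS j : (j < n)%N -> J S`_j.
  move=> jn; have jm : (j <= m)%N by rewrite /m; lia.
  have := GS j jm; rewrite coefD (coef0_exp_lt Y0 jn) addr0 => <-.
  by apply: jet_ideal_jetD => //; apply: mem_ideal_gen.
have JXS : J (X`_1 * S`_n).
  have d1 : d.-1.+1 = d by rewrite prednK.
  have := @square_leading_coef _ J X d.-1 Ji X0; rewrite d1 => /(_ JS).
  have dE : (d%:R : jet_ring k m) = mpolyC (m + m) d%:R by rewrite rmorph_nat.
  rewrite -mulr_natl dE => /(JM (mpolyC _ d%:R^-1)).
  rewrite !mulrA -mpolyCM mulVf; first by rewrite mpolyC1 mul1r.
  by rewrite -d1 natr_neq0.
move=> j jm; rewrite jetDE arc_eval_monom // rmorph1 scale1r expr0 mulr1.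
rewrite exprS -/S coefM; apply: is_ideal_sum => // -[[|[|i]] ij] _ /=.
- by rewrite -/X X0 mul0r.
- have [->|jn] := eqVneq j m; first by rewrite /m subn1.
  by apply: JM; apply: JS; move: jm jn; rewrite /m; lia.
- by apply: JM; apply: JS; move: jm ij; rewrite /m; lia.
Qed.

(** With X = u^n t - (v^n/2) t^(n-1) and Y = u v t, the cross term of X^2 cancels
    Y^n, so g(X, Y) has coefficients in J = (u^(2n), v^(2n)). Modulo J, the powers
    Y^n and Y^(n+1) are non zero, whereas the term u^(2n) v^n t^(n+1) of X Y^n vanishes. *)
Lemma next_order_arc f c0 c1 c2 : jet_closure m I f ->
  high_order m.+1 (f - (fps2_monom c0 0 n + fps2_monom c1 0 n.+1 + fps2_monom c2 1 n)) ->
  c0 = 0 /\ c1 = 0.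
Proof.
set t := _ + fps2_monom c2 1 n => fI ftm.
have tI : jet_closure m I t.
  rewrite -[t](subKr f); apply: (is_idealB (jet_closure_ideal m I)) => //.
  exact: jet_closure_high.
pose al : fps2 k := fps2_monom 1 n 0; pose be : fps2 k := fps2_monom (- 2%:R^-1) 0 n.
pose y : fps2 k := fps2_monom 1 1 1.
pose J := [set F : fps2 k | forall a b, (a < n + n)%N && (b < n + n)%N -> F a b = 0].
have Ji : is_ideal J.
  apply: (@vanishing_ideal k (fun a b => (a < n + n)%N && (b < n + n)%N)).
  by move=> a b a' b'; lia.
have [J0 JD JM] := Ji.
set X := twotermX al be d; set Y := twotermY y.
have X0 : X`_0 = 0 := twotermX0 al be d; have Y0 : Y`_0 = 0 := twotermY0 y.
have gXY : X ^+ 2 + Y ^+ n = al ^+ 2 *: 'X^2 + be ^+ 2 *: 'X^(d.+1 * 2).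
  have mid : (al *: 'X) * (be *: 'X^(d.+1)) *+ 2 + Y ^+ n = 0.
    rewrite -scalerAl -scalerAr scalerA -exprS exprZn scalerMnl -scalerDl.
    rewrite [X in X *: _](_ : _ = 0) ?scale0r //.
    rewrite -mulr_natl -(rmorph_nat (@fps2C k)) /al /be /y fps2_monomMM fps2_monomX /=.
    rewrite fps2C_monom; apply: fps2P => a b; rewrite fps2_addE /fps2_monom.
    rewrite !addn0 !muln1 mul1r mulrN mulfV ?natr_neq0 // expr1n.
    by case: ifP; rewrite ?addNr ?addr0.
  by rewrite sqrrD addrAC -[X in X + _]addrA mid addr0 !exprZn -exprM.
have Jg j : (j <= m)%N -> J (arc_eval (@fps2C k) m X Y g)`_j.
  move=> jm; rewrite arc_eval_binomial // !expr0 mulr1 mul1r gXY coefD !coefZ.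
  apply: JD; apply: (is_idealMr _ Ji) => a b ab; rewrite fps2_monomX /fps2_monom ifF //; lia.
have Jt := jet_closure_arc X0 Y0 Ji Jg tI.
have tE : eqmodt m (arc_eval (@fps2C k) m X Y t)
    (fps2C c0 *: Y ^+ n + fps2C c1 *: Y ^+ n.+1 + fps2C c2 *: (X * Y ^+ n)).
  apply: eqmodt_trans (arc_evalD _ X0 Y0 _ _) _; apply: eqmodtD; last first.
    exact: (arc_eval_monom (@fps2C k) X0 Y0 c2 1 n).
  apply: eqmodt_trans (arc_evalD _ X0 Y0 _ _) _; rewrite -[Y ^+ n]mul1r -[Y ^+ n.+1]mul1r.
  by apply: eqmodtD; apply: (arc_eval_monom (@fps2C k) X0 Y0 _ 0).
have XYE j : (X * Y ^+ n)`_(j + n) = fps2_monom 1 n n * X`_j.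
  rewrite exprZn fps2_monomX expr1n !muln1 -scalerAr coefZ coefMXn.
  by rewrite ltnNge leq_addl addnK.
have YE i j : (Y ^+ i)`_j = fps2_monom 1 i i *+ (j == i).
  by rewrite exprZn coefZ coefXn fps2_monomX expr1n !muln1 mulr_natr.
split.
  have nm : (n <= m)%N by exact: leqnSn.
  have := Jt n nm n n; rewrite tE // !coefD !coefZ !YE (XYE 0%N) X0 !mulr0 addr0 eqxx.
  have -> : (n == n.+1) = false by lia.
  rewrite mulr0n mulr1n mulr0 addr0 fps2C_monom mulr1 /fps2_monom !eqxx; apply.
  by rewrite /n; lia.
have := Jt m (leqnn m) n.+1 n.+1; rewrite tE // !coefD !coefZ !YE (XYE 1%N) eqxx.
have -> : X`_1 = al.
  by rewrite coefD !coefZ coefX coefXn mulr1 ltn_eqF ?mulr0 ?addr0.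
have -> : (m == n) = false by rewrite /m; lia.
rewrite mulr0n mulr1n mulr0 add0r !fps2C_monom fps2_monomMM fps2C_monom !mulr1.
rewrite fps2_addE /fps2_monom !eqxx addn0.
have -> : (n.+1 == n + n)%N = false by rewrite /n; lia.
by rewrite addr0; apply; rewrite /n; lia.
Qed.

(** The remainder of f modulo g reduces to c x y^n up to degree n + 1, and
    x y^n = x g - x^3. *)
Theorem A_next_order_jet_closure :
  jet_closure m (ideal_gen [set fps2X k ^+ 2 + fps2Y k ^+ n]) =
  ideal_add (ideal_add (ideal_exp (fps2_maxideal k) m.+1)
                       (ideal_gen [set fps2X k ^+ 2 + fps2Y k ^+ n]))
            (ideal_gen [set fps2X k ^+ 3]).
Proof.
have -> : fps2X k ^+ 2 + fps2Y k ^+ n = g.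
  by rewrite /g -!fps2_XY !expr0 mulr1 mul1r.
have X3 : fps2X k ^+ 3 = fps2_monom 1 3 0 by rewrite -fps2_XY expr0 mulr1.
have Ci := jet_closure_ideal m I; have [_ CD CM] := Ci.
rewrite -/I X3; apply/seteqP; split; last first.
  move=> _ [_ [u /maxideal_expP um [v vI <-]] [w /ideal_gen1P[h ->] <-]].
  apply: (CD); last by apply: CM; apply: cube_in_jet_closure.
  by apply: CD; [apply: jet_closure_high | apply: jet_closure_sub].
move=> f fI; have [h] := @binomial_division k 0 1 0 n f isT; rewrite -/g !add0n => hf.
pose r := f - h * g.
have rI : jet_closure m I r.
  by apply: (is_idealB Ci) => //; apply: CM; apply/jet_closure_sub/mem_ideal_gen.
pose t c0 c1 c2 : fps2 k := fps2_monom c0 0 n + fps2_monom c1 0 n.+1 + fps2_monom c2 1 n.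
have rt : high_order m.+1 (r - t (r 0%N n) (r 0%N n.+1) (r 1%N n)).
  move=> a b; rewrite ltnS => abm; rewrite /t fps2_addE fps2_oppE !fps2_addE /fps2_monom.
  have [a2|a2] := leqP 2 a.
    have -> : r a b = 0 by have := hf (a - 2)%N b; rewrite subnK // addn0.
    by rewrite !ifF ?addr0 ?subr0 //; lia.
  have [bn|bn] := ltnP b n.
    rewrite (jet_closure_initial rI abm) ?ifF ?addr0 ?subr0 //; lia.
  have e1 : (n == n.+1) = false by lia.
  have e2 : (n.+1 == n) = false by lia.
  have : (a = 0 /\ b = n \/ a = 0 /\ b = n.+1 \/ a = 1 /\ b = n)%N.
    by move: abm bn a2; rewrite /m; lia.
  by case=> [[-> ->]|[[-> ->]|[-> ->]]]; rewrite ?eqxx /= ?e1 ?e2 ?addr0 ?add0r ?eqxx subrr.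
have [c00 c10] := next_order_arc rI rt.
set c2 := r 1%N n in rt; pose e := r - fps2_monom c2 1 n.
have em : high_order m.+1 e.
  move: rt; rewrite /t c00 c10.
  have z a b : fps2_monom (0 : k) a b = 0.
    by apply: fps2P => i j; rewrite /fps2_monom if_same.
  by rewrite !z !add0r.
exists (e + (h + fps2_monom c2 1 0) * g).
  exists e; first exact/maxideal_expP.
  by exists ((h + fps2_monom c2 1 0) * g) => //; apply/ideal_gen1P; eexists.
exists (- fps2C c2 * fps2_monom 1 3 0); first by apply/ideal_gen1P; eexists.
rewrite /e /r mulrDl.
have -> : fps2_monom c2 1 0 * g = fps2_monom c2 3 0 + fps2_monom c2 1 n.
  by rewrite /g mulrDr !fps2_monomMM !mulr1.
rewrite mulNr fps2C_monom mulr1; ring.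
Qed.

End NextOrder.
End BinomialClosure.

(** * The simple plane curve singularities *)

Theorem theoremB (k : closedFieldType) (char0 : [pchar k] =i pred0) (m : nat) :
  let x := fps2X k in
  let y := fps2Y k in
  let M := fps2_maxideal k in
  [/\
   (* A_(n-1) *)
   forall n : nat, (3 <= n)%N ->
     let I := ideal_gen [set x ^+ 2 + y ^+ n] in
     ((m <= n)%N ->
        jet_closure m I = ideal_add I (ideal_exp M m.+1)) /\
     (m = n.+1 ->
        jet_closure m I =
        ideal_add (ideal_add (ideal_exp M m.+1) I) (ideal_gen [set x ^+ 3])),
   (* D_n *)
   forall n : nat, (4 <= n)%N ->
     let I := ideal_gen [set x ^+ 2 * y + y ^+ n.-1] in
     (m <= n.-1)%N -> jet_closure m I = ideal_add I (ideal_exp M m.+1),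
   (* E_6 *)
   let I := ideal_gen [set x ^+ 3 + y ^+ 4] in
     (m <= 4)%N -> jet_closure m I = ideal_add I (ideal_exp M m.+1),
   (* E_7 *)
   let I := ideal_gen [set x ^+ 3 + x * y ^+ 3] in
     (m <= 4)%N -> jet_closure m I = ideal_add I (ideal_exp M m.+1) &
   (* E_8 *)
   let I := ideal_gen [set x ^+ 3 + y ^+ 5] in
     (m <= 5)%N -> jet_closure m I = ideal_add I (ideal_exp M m.+1)].
Proof.
move=> x y M; have thm := binomial_jet_closure char0.
split.
- move=> n n3 /=; split=> [mn|mn].
    have := thm 0 1 0 n m; rewrite !expr0 mulr1 mul1r !add0n; apply => //; exact: ltnW.
  case: n n3 mn => [//|[//|d]] d3 ->.
  exact: A_next_order_jet_closure.
- move=> n n4 /= mn; have := thm 0 1 1 (n - 2)%N m.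
  have -> : (1 + (n - 2) = n.-1)%N by lia.
  by rewrite expr0 mul1r expr1; apply; lia.
- by have := thm 0 2 0 4 m; rewrite !expr0 mulr1 mul1r !add0n; apply.
- by have := thm 1 1 0 3 m; rewrite !expr0 mulr1 expr1 add0n; apply.
- by have := thm 0 2 0 5 m; rewrite !expr0 mulr1 mul1r !add0n; apply.
Qed.
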